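(* Let $(P_\theta)_{\theta\in\Theta}$ be a parametric family of distributions on the space $\mathscr{D}$ of finite point patterns in a planar compact domain $D$, where each $P_\theta$ has a hereditary density $h_\theta$ with respect to the distribution $\mu$ of the unit-intensity Poisson point process on $D$, and let $\lambda_\theta$ denote the Papangelou conditional intensity of $P_\theta$. Let $\rho$ be a non-negative integrable function on $D$ and define, for $\theta,\theta^*\in\Theta$, $$M^\rho(\theta,\theta^* )=\int_{D\times\mathscr{D}}\log\frac{\lambda_\theta(u,X)}{\lambda_\theta(u,X)+\rho(u)}\,C^!_{\theta^*}(du,dX)-\int_D\int_{\mathscr{D}}\rho(u)\log\left(\lambda_\theta(u,X)+\rho(u)\right)P_{\theta^*}(dX)\,du .$$ Then for every $\theta^*\in\Theta$ the function $M^\rho(\cdot,\theta^* )$ has a global maximum at $\theta=\theta^*$. Moreover, if $\mathbf{X}\sim P_{\theta^*}$ and $\mathbf{Y}$ is a point process on $D$, independent of $\mathbf{X}$, with intensity function $\rho$, then $$\sum_{x\in\mathbf{X}}\log\frac{\lambda_\theta(x,\mathbf{X}\setminus\{x\})}{\lambda_\theta(x,\mathbf{X}\setminus\{x\})+\rho(x)}-\sum_{y\in\mathbf{Y}}\log\left(\lambda_\theta(y,\mathbf{X})+\rho(y)\right)$$ is an unbiased estimator of $M^\rho(\theta,\theta^* )$, i.e. its expectation equals $M^\rho(\theta,\theta^* )$, for every $\theta\in\Theta$.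
   Context: A density $h$ on $\mathscr{D}$ with respect to $\mu$ is hereditary if for all $x\in D$, $X\in\mathscr{D}$: $h(X)=0\Rightarrow h(X\cup\{x\})=0$. The reduced Campbell measure $C^!_\theta$ of $P_\theta$ on $D\times\mathscr{D}$ is $C^!_\theta(\phi)=\mathrm{E}\sum_{x\in\mathbf{X}}\phi(x,\mathbf{X}\setminus\{x\})$, $\mathbf{X}\sim P_\theta$. It is known (may be used) that for hereditary $h_\theta$ one has $C^!_\theta(dx,dX)=\lambda_\theta(x,X)\,dx\,P_\theta(dX)$ with Papangelou conditional intensity $\lambda_\theta(x,X)=h_\theta(X\cup\{x\})/h_\theta(X)$; $\lambda_\theta$ is a fixed everywhere-defined non-negative measurable function (any convention may be used for $0/0$). Conventions: $\log 0=-\infty$, $0\cdot\log 0=0$; the two integrals defining $M^\rho(\theta,\theta^* )$ are assumed to be absolutely convergent. A point process $\mathbf{Y}$ has intensity function $\rho$ if $\mathrm{E}\sum_{y\in\mathbf{Y}}g(y)=\int_D g(y)\rho(y)\,dy$ for all non-negative measurable $g$. *)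

(* Defs.v *)
From HB Require Import structures.
From mathcomp Require Import all_boot all_order all_algebra finmap.
From mathcomp Require Import all_classical all_reals all_analysis.
From mathcomp Require Import measurable_realfun.

Set Implicit Arguments.
Unset Strict Implicit.
Unset Printing Implicit Defensive.

Import Order.TTheory GRing.Theory Num.Theory.
Import numFieldNormedType.Exports.

Local Open Scope classical_set_scope.
Local Open Scope ring_scope.

Section point_patterns.
Context {d : measure_display} {T : measurableType d}.
Implicit Types (D B : set T) (x : T).

(* Finite subsets of D, with the sigma-algebra generated by the counts of
   points in measurable sets. *)
Definition pattern D := {X : {fset T} | `[< [set` X] `<=` D >]}.

HB.instance Definition _ D := Choice.on (pattern D).

Definition count D B (X : pattern D) : nat :=
  #|` [fset x in val X | x \in B]|%fset.

Lemma addp_subproof D (X : {fset T}) :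
  `[< [set` [fset y in X | y \in D]%fset] `<=` D >].
Proof. by apply/asboolP => y /=; rewrite !inE/= => /andP[_ /set_mem]. Qed.

(* The result is cut down to D to be total in x; it is X U {x} for x in D. *)
Definition addp D x (X : pattern D) : pattern D :=
  Sub [fset y in (x |` val X)%fset | y \in D]%fset (addp_subproof D _).

Lemma delp_subproof D x (X : pattern D) :
  `[< [set` (val X `\ x)%fset] `<=` D >].
Proof.
apply/asboolP => y /=; rewrite !inE => /andP[_ yX].
by have /asboolP := valP X; apply.
Qed.

Definition delp D x (X : pattern D) : pattern D :=
  Sub (val X `\ x)%fset (delp_subproof x X).

Lemma pattern0_subproof D : `[< [set` (fset0 : {fset T})] `<=` D >].
Proof. by apply/asboolP => y. Qed.

HB.instance Definition _ D :=
  isPointed.Build (pattern D) (Sub fset0 (pattern0_subproof D)).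

Definition count_events D : set (set (pattern D)) :=
  [set [set X | count B X = n] | B in measurable & n in [set: nat]].

HB.instance Definition _ D :=
  @isMeasurable.Build (sigma_display (@count_events D)) (pattern D)
    <<s @count_events D >> (@sigma_algebra0 _ setT _) (@sigma_algebraC _ _)
    (@sigma_algebra_bigcup _ setT _).

End point_patterns.

Section campbell.
Context {d : measure_display} {T : measurableType d} {D : set T} {R : realType}.
Local Open Scope ereal_scope.

(* sum over x in X of f(x, X \ {x}) *)
Definition removal_sum (f : T -> pattern D -> \bar R) (X : pattern D) : \bar R :=
  \sum_(x <- val X) f x (delp x X).

Definition reduced_campbell (P : set (pattern D) -> \bar R)
    (A : set (T * pattern D)) : \bar R :=
  \int[P]_X removal_sum (fun x Y => (\1_A (x, Y))%:E) X.

Let Phi (A : set (T * pattern D)) : pattern D -> \bar R :=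
  removal_sum (fun x Y => (\1_A (x, Y))%:E).

Let Phi_ge0 A X : 0 <= Phi A X.
Proof. by apply: sume_ge0 => x _; rewrite lee_fin. Qed.

Let PhiE A X : Phi A X = (\sum_(x <- val X) \1_A (x, delp x X))%:E.
Proof. by rewrite /Phi /removal_sum sumEFin. Qed.

Let indic_bigcup_trivIset (F : nat -> set (T * pattern D)) z :
  trivIset setT F ->
  (\1_(\bigcup_i F i) z)%:E = \sum_(i <oo) (\1_(F i) z)%:E :> \bar R.
Proof.
move=> tF; case: (pselect ((\bigcup_i F i) z)) => Fz; last first.
  rewrite indicE memNset// eseries0// => i _ _.
  by rewrite indicE memNset// => Fiz; apply: Fz; exists i.
rewrite indicE mem_set//; case: Fz => n _ Fnz.
rewrite (@nneseriesD1 _ _ n)//= indicE mem_set// eseries0 ?adde0// => i _ /eqP ni.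
rewrite indicE memNset// => Fiz; apply: ni.
by apply: (tF i n) => //; exists z.
Qed.

Let Phi_bigcup F X : trivIset setT F ->
  Phi (\bigcup_i F i) X = \sum_(i <oo) Phi (F i) X.
Proof.
move=> tF; rewrite /Phi /removal_sum nneseries_sum; last first.
  by move=> i j _; rewrite lee_fin.
by apply: eq_bigr => x _; exact: indic_bigcup_trivIset.
Qed.

Let Phi_setIC A H X : Phi (A `&` ~` H) X = Phi A X - Phi (A `&` H) X.
Proof.
rewrite !PhiE -EFinB -sumrB; congr (_%:E); apply: eq_bigr => x _.
rewrite indicI indicC indicI/= [\1_H _]indicE.
by case: (_ \in H); rewrite /= ?mulr0 ?mulr1 ?subr0 ?subrr.
Qed.

Let split_class : set (set (T * pattern D)) := [set A |
  forall B, measurable B -> measurable_fun setT (Phi (A `&` (B `*` setT)))].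

Let good : set (set (T * pattern D)) :=
  [set H | forall A, split_class A -> split_class (A `&` H)].

Let good_sigma_algebra : sigma_algebra setT good.
Proof.
apply: dynkin_setI_sigma_algebra; last first.
  by move=> G H gG gH A sA; rewrite setIA; apply: gH; exact: gG.
split.
- by move=> A; rewrite setIT.
- move=> H gH A sA B mB; rewrite setIAC.
  apply: (eq_measurable_fun (fun X => Phi (A `&` (B `*` setT)) X -
      Phi (A `&` H `&` (B `*` setT)) X)).
    by move=> X _; rewrite Phi_setIC setIAC.
  by apply: emeasurable_funB; [exact: sA|exact: gH].
- move=> F tF gF A sA B mB; rewrite setIAC setI_bigcupr.
  apply: (eq_measurable_fun (fun X => \sum_(i <oo | i \in predT)
      Phi (A `&` (B `*` setT) `&` F i) X)).
    by move=> X _; rewrite Phi_bigcup//; exact: trivIset_setIl.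
  apply: ge0_emeasurable_sum => // i _; rewrite setIAC.
  exact: gF.
Qed.

Let mcount B n : measurable B -> measurable [set X : pattern D | count B X = n].
Proof. by move=> mB; apply: sub_sigma_algebra; exists B => //; exists n. Qed.

Let count_delp C (x : T) (X : pattern D) : x \in val X ->
  count C X = ((x \in C) + count C (delp x X))%N.
Proof.
move=> xX; rewrite /count /=.
rewrite (cardfsD1 x) !inE xX/=; congr (_ + _)%N.
suff -> : ([fset y in val X | y \in C] `\ x =
  [fset y in val X `\ x | y \in C])%fset by [].
by apply/fsetP => y; rewrite !inE/= andbA.
Qed.

Let good_count C n : measurable C ->
  good (setT `*` [set X | count C X = n]).
Proof.
move=> mC A sA B mB.
apply: (eq_measurable_fun (fun X =>
    (\1_[set X : pattern D | count C X = n] X)%:E *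
      Phi (A `&` ((B `\` C) `*` setT)) X +
    (\1_[set X : pattern D | count C X = n.+1] X)%:E *
      Phi (A `&` ((B `&` C) `*` setT)) X)).
  move=> X _; rewrite !PhiE -!EFinM -EFinD !mulr_sumr -big_split/=.
  congr (_%:E); apply: eq_big_seq => x xX.
  have := @count_delp C x X xX.
  have IX A' (B' : set T) Y : ((x, Y) \in A' `&` (B' `*` setT)) =
      ((x, Y) \in A') && (x \in B') :> bool.
    by rewrite in_setI in_setX in_setT andbT.
  rewrite !indicE !IX [_ \in A `&` _]in_setI in_setX in_setT in_setD.
  rewrite [_ \in B `&` _]in_setI /=.
  have E m Y : (Y \in [set X : pattern D | count C X = m]) = (count C Y == m).
    by apply/idP/eqP => [/set_mem//|?]; exact: mem_set.
  rewrite !E -!natrM -natrD; case: (x \in C) => /= ->.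
    rewrite add1n eqSS !(andbF, andbT, muln0, add0n) !mulnb; congr (_%:R).
    by case: (_ \in A); case: (_ \in B); rewrite ?andbF ?andbT.
  rewrite add0n !(andbF, andbT, muln0, addn0) !mulnb; congr (_%:R).
  by case: (_ \in A); case: (_ \in B); rewrite ?andbF ?andbT.
by apply: emeasurable_funD; apply: emeasurable_funM;
  [apply/measurable_EFinP; apply: measurable_indic; exact: mcount
  |apply: sA; exact: measurableD
  |apply/measurable_EFinP; apply: measurable_indic; exact: mcount
  |apply: sA; exact: measurableI].
Qed.

Let measurable_count B : measurable B -> measurable_fun setT (@count _ T D B).
Proof.
move=> mB _ U _; rewrite setTI.
rewrite (_ : _ @^-1` U = \bigcup_(n in U) [set X : pattern D | count B X = n]).
  by apply: bigcup_measurable => n _; exact: mcount.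
by apply/seteqP; split=> [X UX|X [n Un /= ->]//]; exists (count B X).
Qed.

Let split_classT : split_class setT.
Proof.
move=> B mB; rewrite setTI.
apply: (eq_measurable_fun (fun X => (count B X)%:R%:E)).
  move=> X _; rewrite PhiE; congr (_%:E).
  rewrite /count card_fset_sum1 big_fset/= natr_sum big_mkcond/=.
  apply: eq_bigr => x _; rewrite indicE in_setX in_setT andbT.
  by case: (x \in B).
apply/measurable_EFinP.
apply: (@measurableT_comp _ _ _ _ nat _ (fun n => n%:R : R)) => //.
exact: measurable_count.
Qed.

Lemma measurable_removal_indic A : measurable A ->
  measurable_fun setT (removal_sum (fun x Y => (\1_A (x, Y))%:E)).
Proof.
move=> mA; suff : good A.
  move=> /(_ _ split_classT) /(_ _ measurableT).
  by rewrite setTI setXTT setIT.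
move: A mA; apply: smallest_sub; first exact: good_sigma_algebra.
move=> _ [[B mB <-]|[F mF <-]].
  move=> A sA C mC; have := sA _ (measurableI _ _ mB mC).
  congr (measurable_fun _ (Phi _)); apply/seteqP; split => -[x X]/=; tauto.
rewrite setTI; move: F mF.
have [g0 gC gU] := good_sigma_algebra.
apply: (@smallest_sub _ _ _ [set F | good (snd @^-1` F)]).
  split => /=.
  - by rewrite preimage_set0.
  - by move=> F; rewrite setTD preimage_setC -setTD; exact: gC.
  - by move=> F gF; rewrite preimage_bigcup; exact: gU.
move=> _ [C mC [n _ <-]] /=.
have := good_count n mC; congr good.
by apply/seteqP; split => -[x X]/=; tauto.
Qed.

Variable P : {measure set (pattern D) -> \bar R}.

Let reduced_campbell0 : reduced_campbell P set0 = 0.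
Proof.
apply: integral0_eq => X _; rewrite /removal_sum big1// => x _.
by rewrite indic0.
Qed.

Let reduced_campbell_ge0 A : 0 <= reduced_campbell P A.
Proof. by apply: integral_ge0 => X _; exact: Phi_ge0. Qed.

Let reduced_campbell_sigma_additive : semi_sigma_additive (reduced_campbell P).
Proof.
move=> F mF tF mUF; apply: cvg_toP.
  by apply: is_cvg_ereal_nneg_natsum => n _; exact: reduced_campbell_ge0.
rewrite -integral_nneseries//.
- by apply: eq_integral => X _; rewrite [RHS]Phi_bigcup.
- by move=> n; exact: measurable_removal_indic.
- by move=> n X _; exact: Phi_ge0.
Qed.

HB.instance Definition _ := isMeasure.Build _ _ _ (reduced_campbell P)
  reduced_campbell0 reduced_campbell_ge0 reduced_campbell_sigma_additive.

End campbell.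

Definition plane (R : realType) : Type :=
  (measurableTypeR R * measurableTypeR R)%type.

Definition area (R : realType) : {measure set (plane R) -> \bar R} :=
  (@lebesgue_measure R \x @lebesgue_measure R)%E.

Section papangelou.
Context {R : realType} {D : set (plane R)}.
Implicit Types (P mu : probability (pattern D) R) (h : pattern D -> R)
  (lambda : plane R -> pattern D -> R) (rho : plane R -> R).

(* [poisson_pmf] of the library is not used because its value for rate 0 is
   constantly 1, while a null set must contain 0 points almost surely. *)
Definition poisson_weight (r : R) (k : nat) : R := r ^+ k / k`!%:R * expR (- r).

(* Law of the Poisson process on D with intensity measure the area: the counts
   of pairwise disjoint regions are independent and Poisson distributed. *)
Definition unit_poisson mu : Prop :=
  forall (n : nat) (B : 'I_n -> set (plane R)) (k : 'I_n -> nat),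
    (forall i, measurable (B i)) -> (forall i, B i `<=` D) ->
    trivIset [set: 'I_n] B ->
    mu [set X | forall i, count (B i) X = k i] =
    (\prod_(i < n) poisson_weight (fine (area R (B i))) (k i))%:E.

Definition is_density mu P h : Prop :=
  [/\ measurable_fun setT h, forall X, 0 <= h X &
      forall A, measurable A -> P A = (\int[mu]_(X in A) (h X)%:E)%E].

Definition hereditary h : Prop :=
  forall x X, D x -> h X = 0 -> h (addp x X) = 0.

(* Where h X = 0, hence h (X U {x}) = 0, the value of lambda is left free. *)
Definition papangelou_intensity h lambda : Prop :=
  [/\ measurable_fun (D `*` [set: pattern D]) (fun z => lambda z.1 z.2),
      forall x X, D x -> 0 <= lambda x X &
      forall x X, D x -> h X != 0 -> lambda x X = h (addp x X) / h X].

Local Open Scope ereal_scope.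

(* log (lambda / (lambda + rho)) with log 0 = -oo; since x / 0 = 0 here, the
   value is also -oo where lambda = rho = 0. *)
Definition log_ratio lambda rho (u : plane R) (X : pattern D) : \bar R :=
  lne (lambda u X / (lambda u X + rho u))%:E.

Definition log_total lambda rho (u : plane R) (X : pattern D) : \bar R :=
  lne (lambda u X + rho u)%:E.

Definition Mrho lambda rho P : \bar R :=
  \int[reduced_campbell P]_(z in D `*` setT) log_ratio lambda rho z.1 z.2 -
  \int[area R]_(u in D) \int[P]_X ((rho u)%:E * log_total lambda rho u X).

Definition Mrho_converges lambda rho P : Prop :=
  \int[reduced_campbell P]_(z in D `*` setT) `|log_ratio lambda rho z.1 z.2|
    < +oo /\
  \int[area R]_(u in D) \int[P]_X `|(rho u)%:E * log_total lambda rho u X|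
    < +oo.

Context {d : measure_display} {Omega : measurableType d}
  (Pr : probability Omega R).
Implicit Types X Y : {RV Pr >-> pattern D}.

Definition has_law X P : Prop :=
  forall A, measurable A -> distribution Pr X A = P A.

Definition independent_patterns X Y : Prop :=
  forall A B, measurable A -> measurable B ->
    Pr (X @^-1` A `&` Y @^-1` B) = Pr (X @^-1` A) * Pr (Y @^-1` B).

Definition has_intensity Y rho : Prop :=
  forall g : plane R -> R, measurable_fun D g ->
    (forall y, D y -> (0 <= g y)%R) ->
    \int[Pr]_w (\sum_(y <- val (Y w)) (g y)%:E) =
    \int[area R]_(y in D) (g y * rho y)%:E.

Definition estimator lambda rho X Y (w : Omega) : \bar R :=
  removal_sum (log_ratio lambda rho) (X w) -
  \sum_(y <- val (Y w)) log_total lambda rho y (X w).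

Definition unbiased_for (Z : Omega -> \bar R) (m : \bar R) : Prop :=
  Pr.-integrable [set: Omega] Z /\ \int[Pr]_w Z w = m.

End papangelou.

(* Main.v *)
Require Import Defs.
From HB Require Import structures.
From mathcomp Require Import all_boot all_order all_algebra finmap.
From mathcomp Require Import all_classical all_reals all_analysis.
From mathcomp Require Import measurable_realfun random_variable.
From mathcomp Require Import ring lra.
Import Order.TTheory GRing.Theory Num.Theory.
Import numFieldNormedType.Exports.
Local Open Scope classical_set_scope.
Local Open Scope ring_scope.

(** Disintegrating the reduced Campbell measure of P_theta* by the Georgii-
    Nguyen-Zessin formula turns M^rho(theta, theta* ) into the integral over
    D x patterns, with respect to du P_theta*(dX), of
      a log (c / (c + r)) - r log (c + r),
    where a = lambda_theta*(u, X), c = lambda_theta(u, X) and r = rho(u).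
    For fixed a and r this is largest at c = a: up to the constant r log r it
    is (a + r) times the expected log-likelihood of a Bernoulli law of
    parameter c / (c + r) under the one of parameter a / (a + r).

    The Georgii-Nguyen-Zessin formula follows from Mecke's formula for the
    Poisson process, which is checked on the events that depend only on the
    numbers of points in the cells of a finite partition: there it reduces to
    (k + 1) w(k + 1) = r w(k) for the Poisson weights w of rate r.

    The expectation of the estimator is computed with the reduced Campbell
    measure of X and with the intensity of Y, independence being used to
    factor the joint intensity of the points of Y and of the pattern X. *)

(** * Integration with respect to mixtures of point masses *)

Section ge0_transfer.
Context {d d' : measure_display} {T : measurableType d}
  {Omega : measurableType d'} {R : realType} {I : Type}.
Local Open Scope ereal_scope.

Variables (P : {measure set Omega -> \bar R}) (m : {measure set T -> \bar R}).
Variables (s : Omega -> seq I) (p : Omega -> I -> T) (r : T -> R).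
Hypotheses (mr : measurable_fun setT r) (r_ge0 : forall z, (0 <= r z)%R).

(* With a single index K is a composition; with the points of a pattern as
   indices it is the integrand of a Campbell measure. *)
Let K (f : T -> \bar R) (w : Omega) : \bar R := \sum_(i <- s w) f (p w i).
Let Q (f : T -> \bar R) :=
  measurable_fun setT (K f) /\ \int[P]_w K f w = \int[m]_z (f z * (r z)%:E).

Hypothesis Q_indic : forall A, measurable A -> Q (fun z => (\1_A z)%:E).

Let mrE : measurable_fun setT (EFin \o r).
Proof. exact/measurable_EFinP. Qed.

Let K_ge0 f w : (forall z, 0 <= f z) -> 0 <= K f w.
Proof. by move=> f0; apply: sume_ge0 => i _. Qed.

Let Q_scale (k : R) f : (0 <= k)%R -> measurable_fun setT f ->
  (forall z, 0 <= f z) -> Q f -> Q (fun z => k%:E * f z).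
Proof.
move=> k0 mf f0 [mKf QE].
have KE w : K (fun z => k%:E * f z) w = k%:E * K f w.
  by rewrite /K ge0_sume_distrr.
split; first by rewrite (_ : K _ = fun w => k%:E * K f w);
  [exact: measurable_funeM|exact/funext].
under eq_integral do rewrite KE.
rewrite ge0_integralZl//; last by move=> w _; exact: K_ge0.
rewrite QE -ge0_integralZl//.
- by apply: eq_integral => z _; rewrite muleA.
- by apply: emeasurable_funM => //; exact: mrE.
- by move=> z _; apply: mule_ge0 => //; rewrite lee_fin.
Qed.

Let Q_add f g : measurable_fun setT f -> measurable_fun setT g ->
  (forall z, 0 <= f z) -> (forall z, 0 <= g z) -> Q f -> Q g -> Q (f \+ g).
Proof.
move=> mf mg f0 g0 [mKf QEf] [mKg QEg].
have KE w : K (f \+ g) w = K f w + K g w by rewrite /K big_split.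
split; first by rewrite (_ : K _ = K f \+ K g);
  [exact: emeasurable_funD|exact/funext].
under eq_integral do rewrite KE.
rewrite ge0_integralD//; [|by move=> w _; exact: K_ge0..].
rewrite QEf QEg -ge0_integralD//.
- by apply: eq_integral => z _; rewrite ge0_muleDl.
- by move=> z _; apply: mule_ge0 => //; rewrite lee_fin.
- by apply: emeasurable_funM => //; exact: mrE.
- by move=> z _; apply: mule_ge0 => //; rewrite lee_fin.
- by apply: emeasurable_funM => //; exact: mrE.
Qed.

Import HBNNSimple.

Let Q_nnsfun (g : {nnsfun T >-> R}) : Q (fun z => (g z)%:E).
Proof.
have -> : (fun z => (g z)%:E) = (fun z => \sum_(y <- fset_set (range g))
    (y * \1_(g @^-1` [set y]) z)%:E).
  by apply/funext => z; rewrite fimfunE fsbig_finite//= sumEFin.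
(* Non-negativity of the values stays in the goal, so that the induction on their list carries it
   along. *)
have : {in (fset_set (range g) : seq R), forall y, (0 <= y)%R}.
  move=> y; rewrite in_fset_set// inE => -[z _ <-]; exact: fun_ge0.
elim: (fset_set _ : seq R) => [_|y t IH yt0].
  have -> : (fun z : T => \sum_(y <- [::]) (y * \1_(g @^-1` [set y]) z)%:E) =
      (fun z => (\1_(set0 : set T) z)%:E :> \bar R).
    by apply/funext => z; rewrite big_nil indic0.
  exact: Q_indic.
have -> : (fun z : T => \sum_(x <- y :: t) (x * \1_(g @^-1` [set x]) z)%:E) =
    (fun z => y%:E * (\1_(g @^-1` [set y]) z)%:E) \+
    (fun z => \sum_(x <- t) (x * \1_(g @^-1` [set x]) z)%:E).
  by apply/funext => z; rewrite big_cons.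
have y0 : (0 <= y)%R by apply: yt0; rewrite mem_head.
have t0 : {in t, forall x, (0 <= x)%R}.
  by move=> x xt; apply: yt0; rewrite in_cons xt orbT.
have mi x : measurable_fun setT (fun z => (\1_(g @^-1` [set x]) z)%:E : \bar R).
  by apply/measurable_EFinP; exact: measurable_indic.
apply: Q_add.
- exact: measurable_funeM.
- apply: emeasurable_sum => x; apply/measurable_EFinP.
  by apply: measurable_funM => //; apply/measurable_EFinP; exact: mi.
- by move=> z; rewrite mule_ge0// lee_fin.
- move=> z; rewrite big_seq; apply: sume_ge0 => x xt.
  by rewrite lee_fin mulr_ge0// t0.
- apply: Q_scale => //; last by apply: Q_indic; exact: measurable_funPTI.
- exact: IH.
Qed.

Let Q_lim (f_ : nat -> T -> \bar R) (f : T -> \bar R) :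
  (forall n, measurable_fun setT (f_ n)) -> (forall n z, 0 <= f_ n z) ->
  (forall z, {homo f_ ^~ z : a b / (a <= b)%N >-> a <= b}) ->
  (forall z, f_ ^~ z @ \oo --> f z) ->
  (forall n, Q (f_ n)) -> Q f.
Proof.
move=> mf f0 nd cv Qf.
have Kcv w : K (f_ n) w @[n --> \oo] --> K f w.
  rewrite /K; apply: cvg_nnesum => [i _|i _].
    by near=> n; exact: f0.
  exact: cv.
have Knd w : {homo (fun n => K (f_ n) w) : a b / (a <= b)%N >-> a <= b}.
  by move=> a b ab; apply: lee_sum => i _; exact: nd.
have mK : measurable_fun setT (K f).
  apply: (emeasurable_fun_cvg (fun n => K (f_ n))) => // n.
  exact: (Qf n).1.
split => //.
have L : \int[P]_w K (f_ n) w @[n --> \oo] --> \int[P]_w K f w.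
  have := @cvg_monotone_convergence _ _ _ P setT measurableT
    (fun n => K (f_ n)) (fun n => (Qf n).1) (fun n w _ => K_ge0 (f_ n) w (f0 n))
    (fun w _ => Knd w).
  by under [X in _ --> X -> _]eq_integral do rewrite (cvg_lim _ (Kcv _))//.
have L' : \int[m]_z (f_ n z * (r z)%:E) @[n --> \oo] --> \int[m]_z (f z * (r z)%:E).
  have -> : \int[m]_z (f z * (r z)%:E) = \int[m]_z limn (fun n => f_ n z * (r z)%:E).
    apply: eq_integral => z _; apply/esym/cvg_lim => //.
    by apply: cvgeZr => //; exact: cv.
  apply: cvg_monotone_convergence => //.
  - by move=> n; apply: emeasurable_funM => //; exact: mrE.
  - by move=> n z _; apply: mule_ge0 => //; rewrite lee_fin.
  - by move=> z _ a b ab; apply: lee_pmul => //; rewrite ?lee_fin//; exact: nd.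
rewrite -(cvg_lim _ L)// -(cvg_lim _ L')//; congr (lim (_ @ \oo)).
by apply/funext => n; exact: (Qf n).2.
Unshelve. all: by end_near. Qed.

(** The usual extension from indicators: [Q] survives non-negative multiples, sums and increasing
    limits, hence reaches every non-negative measurable function. It is applied below to densities,
    to the reduced Campbell measure, and twice to a pair of independent patterns. *)
Lemma ge0_integral_transfer f : measurable_fun setT f ->
  (forall z, 0 <= f z) -> Q f.
Proof.
move=> mf f0; pose g := nnsfun_approx measurableT mf.
apply: (@Q_lim (fun n z => (g n z)%:E)) => //.
- by move=> n; apply/measurable_EFinP.
- by move=> n z; rewrite lee_fin.
- by move=> z a b ab; rewrite lee_fin; exact/lefP/nd_nnsfun_approx.
- by move=> z; exact: cvg_nnsfun_approx.
Qed.

End ge0_transfer.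

(** * Counting points in the cells of a partition *)

(** Sigma-additivity along the enumeration of [I] by [pickle]; codes that represent no element
    contribute the empty set. *)
Lemma eq_measure_countable_bigcup {d} {T : measurableType d} {R : realType}
    (m1 m2 : {measure set T -> \bar R}) (I : countType) (A : I -> set T) :
  (forall i, measurable (A i)) -> trivIset setT A ->
  (forall i, m1 (A i) = m2 (A i)) ->
  m1 (\bigcup_i A i) = m2 (\bigcup_i A i).
Proof.
move=> mA tA AE; pose B n := oapp A set0 (@pickle_inv I n).
have BU : \bigcup_i A i = \bigcup_n B n.
  apply/seteqP; split=> [x [i _ Aix]|x [n _]].
    by exists (choice.pickle i) => //; rewrite /B pickleK_inv.
  by rewrite /B; case: pickle_inv => //= i; exists i.
have mB n : measurable (B n) by rewrite /B; case: pickle_inv => /=.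
have tB : trivIset setT B.
  move=> n k _ _ [x []]; rewrite /B.
  have := @pickle_invK I n; have := @pickle_invK I k.
  case: pickle_inv => //= i; case: pickle_inv => //= j ik jn Ajx Aix.
  by rewrite -ik -jn (tA i j)//; exists x.
rewrite BU !measure_bigcup//; apply: eq_eseriesr => n _.
by rewrite /B; case: pickle_inv => //=; rewrite !measure0.
Qed.

Local Notation count := Defs.count.

Section label_counts.
Context {d : measure_display} {T : measurableType d} {D : set T}.
Implicit Types (B C : set T) (X : pattern D).

Lemma val_pattern_sub X x : x \in val X -> D x.
Proof. by move=> xX; have /asboolP := valP X; apply. Qed.

Lemma countE B X : count B X = (\sum_(x <- val X) (x \in B))%N.
Proof.
rewrite /count card_fset_sum1 big_fset/= big_mkcond/=.
by apply: eq_bigr => x _; case: ifP.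
Qed.

Lemma count_setI B X : count (D `&` B) X = count B X.
Proof.
rewrite !countE; apply: eq_big_seq => x /val_pattern_sub Dx.
by rewrite in_setI (mem_set Dx).
Qed.

Lemma count_delp B x X : x \in val X ->
  count B X = ((x \in B) + count B (delp x X))%N.
Proof.
by move=> xX; rewrite !countE (big_fsetD1 x)//=.
Qed.

Lemma measurable_count_eq B n : measurable B ->
  measurable [set X : pattern D | count B X = n].
Proof. by move=> mB; apply: sub_sigma_algebra; exists B => //; exists n. Qed.

(* A label with values in a finite type stands for the finite partition of T
   into its fibres; pairing two labels gives the common refinement. *)
Definition label_counts {I : finType} (l : T -> I) X : {ffun I -> nat} :=
  [ffun i => count (l @^-1` [set i]) X].

Definition measurable_label {I : finType} (l : T -> I) :=
  forall i, measurable (l @^-1` [set i]).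

(** A cell of the coarser partition is the union of the cells that [f] merges into it. This recovers
    the counts of a label from those of any refinement. *)
Lemma label_counts_comp {I J : finType} (l : T -> I) (f : I -> J) X :
  label_counts (f \o l) X =
  [ffun j => (\sum_(i | f i == j) label_counts l X i)%N].
Proof.
apply/ffunP => j; rewrite !ffunE countE.
under [RHS]eq_bigr do rewrite ffunE countE.
rewrite exchange_big/=; apply: eq_bigr => x _.
have inE (K : finType) (g : T -> K) k : x \in g @^-1` [set k] = (g x == k).
  by apply/idP/eqP => [/set_mem|?]//; exact: mem_set.
under eq_bigr do rewrite inE.
rewrite inE/= big_mkcond/= (bigD1 (l x))//= eqxx big1 ?addn0; first by case: eqP.
by move=> i /negbTE; rewrite eq_sym => ->; case: ifP.
Qed.

Lemma measurable_label_pair {I J : finType} (l : T -> I) (l' : T -> J) :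
  measurable_label l -> measurable_label l' ->
  measurable_label (fun x => (l x, l' x)).
Proof.
move=> ml ml' [i j].
rewrite (_ : _ @^-1` _ = l @^-1` [set i] `&` l' @^-1` [set j]).
  exact: measurableI.
by apply/seteqP; split => x /= => [[-> ->]|[-> ->]].
Qed.

Lemma measurable_label_mem B : measurable B -> measurable_label (mem B).
Proof.
move=> mB [].
  rewrite (_ : _ @^-1` _ = B)//; apply/seteqP; split => x /=.
    by move/set_mem.
  exact: mem_set.
rewrite (_ : _ @^-1` _ = ~` B); first exact: measurableC.
apply/seteqP; split => x /=.
  by move=> /negP + /mem_set; apply.
by move=> Bx; exact: memNset.
Qed.

Lemma measurable_label_counts_eq {I : finType} (l : T -> I) k :
  measurable_label l -> measurable [set X | label_counts l X = k].
Proof.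
move=> ml; rewrite (_ : [set X | _] =
    \big[setI/setT]_i [set X | count (l @^-1` [set i]) X = k i]).
  by apply: bigsetI_measurable => i _; exact: measurable_count_eq.
apply/seteqP; split => X.
  by move=> /= <-; rewrite -bigcap_seq => i _ /=; rewrite ffunE.
rewrite -bigcap_seq => kX; apply/ffunP => i; rewrite ffunE.
by apply: kX; rewrite /= mem_index_enum.
Qed.

(** Enlarging [count_events] in this way gives a class stable under intersection, as a uniqueness
    theorem for measures demands of a generator. *)
Definition label_events : set (set (pattern D)) := [set F |
  exists (I : finType) (l : T -> I) (K : set {ffun I -> nat}),
    measurable_label l /\ F = [set X | K (label_counts l X)]].

(** Each of two labels is a projection of their pair, so both events are conditions on the counts of
    the pair. *)
Lemma setI_closed_label_events : setI_closed label_events.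
Proof.
move=> _ _ [I [l [K [ml ->]]]] [J [l' [K' [ml' ->]]]].
pose f (g : I * J -> I) k : {ffun I -> nat} :=
  [ffun i => (\sum_(j | g j == i) k j)%N].
pose f' (g : I * J -> J) k : {ffun J -> nat} :=
  [ffun i => (\sum_(j | g j == i) k j)%N].
exists (I * J)%type, (fun x => (l x, l' x)),
  [set k : {ffun I * J -> nat} | K (f fst k) /\ K' (f' snd k)].
split; first exact: measurable_label_pair.
by apply/seteqP; split => X /=; rewrite /f/f' -!label_counts_comp.
Qed.

Lemma sub_count_label_events : @count_events _ T D `<=` label_events.
Proof.
move=> _ [B mB [n _ <-]].
exists bool, (mem B), [set k : {ffun bool -> nat} | k true = n].
split; first exact: measurable_label_mem.
have E : mem B @^-1` [set true] = B.
  by apply/seteqP; split => x /= => [/set_mem|/mem_set].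
by apply/seteqP; split => X /=; rewrite ffunE E.
Qed.

(** [K] is arbitrary, but count vectors form a countable type, so the event is a countable union of
    events that fix all counts. *)
Lemma measurable_label_events F : label_events F -> measurable F.
Proof.
move=> [I [l [K [ml ->]]]].
rewrite (_ : [set X | _] = \bigcup_(k in K) [set X | label_counts l X = k]).
  rewrite bigcup_mkcond; apply: countable_bigcupT_measurable => [|k].
    exact: countableP.
  by case: ifP => // _; exact: measurable_label_counts_eq.
by apply/seteqP; split => [X KX|X [k Kk /= ->]//]; exists (label_counts l X).
Qed.

Lemma measurable_prod_label_events :
  @measurable _ (T * pattern D)%type =
  <<s [set B `*` F | B in measurable & F in label_events] >>.
Proof.
set G := (X in <<s X >>).
have [G0 GC GU] : sigma_algebra setT <<s G >> by exact: smallest_sigma_algebra.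
(* The whole space comes from a constant label; it turns the cylinders that generate the product
   sigma-algebra into rectangles. *)
have GT : label_events setT.
  exists unit, (fun=> tt), setT; split => // i.
  by rewrite preimage_cst; case: ifP.
apply/seteqP; split; last first.
  apply: smallest_sub; first exact: sigma_algebra_measurable.
  move=> _ [B mB [F mF <-]]; apply: measurableX => //.
  exact: measurable_label_events.
apply: smallest_sub; first exact: smallest_sigma_algebra.
move=> _ [[B mB <-]|[F mF <-]].
  apply: sub_sigma_algebra; exists B => //; exists setT => //.
  by apply/seteqP; split => -[x X]/=; tauto.
rewrite setTI; move: F mF.
(* The sets whose cylinder lies in the sigma-algebra generated by [G] form a sigma-algebra
   themselves, so count events suffice. *)
apply: (@smallest_sub _ _ _ [set F | <<s G >> (snd @^-1` F)]).
  split => /=.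
  - by rewrite preimage_set0.
  - by move=> F GF; rewrite setTD preimage_setC -setTD; exact: GC.
  - by move=> F GF; rewrite preimage_bigcup; exact: GU.
move=> F /sub_count_label_events GF; apply: sub_sigma_algebra.
exists setT => //; exists F => //.
by apply/seteqP; split => -[x X]/=; tauto.
Qed.

End label_counts.

(** * Mecke and Georgii-Nguyen-Zessin formulas *)

Lemma poisson_weightS (R : realType) (r : R) k :
  k.+1%:R * poisson_weight r k.+1 = r * poisson_weight r k.
Proof.
rewrite /poisson_weight exprS factS natrM invfM.
have k0 : k.+1%:R != 0 :> R by rewrite pnatr_eq0.
have f0 : k`!%:R != 0 :> R by rewrite pnatr_eq0 -lt0n fact_gt0.
field; by rewrite f0 nat1r k0.
Qed.

Section mecke.
Context {d : measure_display} {T : measurableType d} {D : set T} {R : realType}.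
Variables (nu : {finite_measure set T -> \bar R}) (mu : probability (pattern D) R).
Hypothesis mu_poisson : forall (I : finType) (l : T -> I) (k : {ffun I -> nat}),
  measurable_label l -> mu [set X | label_counts l X = k] =
  (\prod_i poisson_weight (fine (nu (l @^-1` [set i]))) (k i))%:E.
Local Open Scope ereal_scope.

Definition ffun_incr {I : finType} (j : I) (k : {ffun I -> nat}) : {ffun I -> nat} :=
  [ffun i => ((i == j) + k i)%N].

Lemma label_counts_delp {I : finType} (l : T -> I) (X : pattern D) x : x \in val X ->
  label_counts l X = ffun_incr (l x) (label_counts l (delp x X)).
Proof.
move=> xX; apply/ffunP => i; rewrite !ffunE (count_delp _ _ _ xX).
congr (nat_of_bool _ + _)%N; rewrite eq_sym.
by apply/idP/eqP => [/set_mem|?]//; exact: mem_set.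
Qed.

Lemma ffun_incr_inj {I : finType} (j : I) : injective (ffun_incr j).
Proof.
move=> k k' /ffunP kk'; apply/ffunP => i.
by have := kk' i; rewrite !ffunE => /addnI.
Qed.

(** A pattern contributes only if its counts are [k] with one more point in cell [j]. Removing any
    of the [k j + 1] points of that cell then yields the counts [k], whence the factor. *)
Lemma removal_sum_label {I : finType} (l : T -> I) (j : I) k (X : pattern D) :
  removal_sum (fun x Y => (\1_(l @^-1` [set j] `*`
    [set X | label_counts l X = k]) (x, Y))%:E) X =
  ((k j).+1%:R * \1_[set X | label_counts l X = ffun_incr j k] X)%:E :> \bar R.
Proof.
rewrite /removal_sum sumEFin; congr (_%:E).
have E (J : finType) (Z : Type) (g : Z -> J) k0 z : z \in g @^-1` [set k0] = (g z == k0).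
  by apply/idP/eqP => [/set_mem|?]//; exact: mem_set.
have E' Y k0 :
    Y \in [set X : pattern D | label_counts l X = k0] = (label_counts l Y == k0).
  by apply/idP/eqP => [/set_mem|?]//; exact: mem_set.
rewrite (eq_big_seq (fun x => ((x \in l @^-1` [set j])%:R *
    \1_[set X | label_counts l X = ffun_incr j k] X)%R)); last first.
  move=> x xX; rewrite !indicE in_setX/= !E' E (label_counts_delp _ _ _ xX).
  case: eqP => [->|_]; last by rewrite mul0r.
  by rewrite (inj_eq (@ffun_incr_inj _ _)) mul1r.
rewrite -big_distrl/= -natr_sum -countE indicE E'.
case: eqP => [/ffunP/(_ j)|_]; last by rewrite !mulr0.
by rewrite !ffunE eqxx => ->.
Qed.

Lemma mecke_label {I : finType} (l : T -> I) (j : I) k : measurable_label l ->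
  reduced_campbell mu (l @^-1` [set j] `*` [set X | label_counts l X = k]) =
  (nu \x mu) (l @^-1` [set j] `*` [set X | label_counts l X = k]).
Proof.
move=> ml; have mk := measurable_label_counts_eq.
rewrite product_measure1E; [|exact: (ml j)|exact: mk].
rewrite /reduced_campbell; under eq_integral do rewrite removal_sum_label EFinM.
rewrite ge0_integralZl//; last first.
  by apply/measurable_EFinP/measurable_indic; exact: mk.
rewrite integral_indic//; last exact: mk.
rewrite setIT [X in _ * X = _]mu_poisson// [X in _ = _ * X]mu_poisson//.
have nuE : nu (l @^-1` [set j]) = (fine (nu (l @^-1` [set j])))%:E.
  by rewrite fineK// fin_num_measure//; exact: ml.
rewrite [X in _ = X * _]nuE.
(* The Poisson weights differ at cell [j] only, where [poisson_weightS] absorbs the factor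
   [k j + 1]. *)
rewrite -!EFinM (bigD1 j)//= [in RHS](bigD1 j)//=.
rewrite ffunE eqxx add1n mulrA poisson_weightS -mulrA; congr (_ * (_ * _))%:E.
by apply: eq_bigr => i /negbTE ij; rewrite ffunE ij.
Qed.

(** After refining [l] by membership in [B], the rectangle is a countable disjoint union of sets
    handled by [mecke_label]. *)
Lemma mecke_label_events B F : measurable B -> label_events F ->
  reduced_campbell mu (B `*` F) = (nu \x mu) (B `*` F).
Proof.
move=> mB [I [l [K [ml ->]]]].
pose l' x := (l x, x \in B).
have ml' : measurable_label l'.
  by apply: measurable_label_pair => //; exact: measurable_label_mem.
pose f k : {ffun I -> nat} := [ffun i => (\sum_(j : I * bool | j.1 == i) k j)%N].
(* [i.1.2] says that the cell lies in [B]; [f] recovers the counts of [l] from those of the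
   refinement. *)
pose P (i : (I * bool) * {ffun I * bool -> nat}) := i.1.2 /\ K (f i.2).
pose A (i : (I * bool) * {ffun I * bool -> nat}) : set (T * pattern D) :=
  if `[< P i >] then l' @^-1` [set i.1] `*` [set X | label_counts l' X = i.2]
  else set0.
have -> : B `*` [set X | K (label_counts l X)] = \bigcup_i A i.
  have KE X : label_counts l X = f (label_counts l' X).
    exact: (label_counts_comp l' fst X).
  apply/seteqP; split => [[x X]/= [Bx KX]|[x X] [[j k] _]].
    exists (l' x, label_counts l' X) => //; rewrite /A ifT//.
    by apply/asboolP; split => /=; [exact: mem_set|rewrite -KE].
  rewrite /A; case: asboolP => //= -[/= j2 Kk] [/= lx Xk].
  by rewrite KE Xk; split => //; move: j2; rewrite -lx => /set_mem.
apply: eq_measure_countable_bigcup => [i|[j k] [j' k'] _ _ [[x X] []]|i].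
- rewrite /A; case: ifP => // _; apply: measurableX; first exact: ml'.
  exact: measurable_label_counts_eq.
- rewrite /A; case: ifP => // _ [/= <- <-].
  by case: ifP => // _ [/= <- <-].
- rewrite /A; case: ifP => _; first exact: mecke_label.
  by rewrite !measure0.
Qed.

(** Finite measures that agree on a generator stable under intersection and containing the whole
    space are equal; the common total mass is that of [nu]. *)
Lemma mecke A : measurable A -> reduced_campbell mu A = (nu \x mu) A.
Proof.
apply: (@measure_unique _ R _ _ (fun=> setT) (@measurable_prod_label_events _ T D)
  _ _ _ (reduced_campbell mu) (nu \x mu)%E).
- move=> _ _ [B mB [F mF <-]] [B' mB' [F' mF' <-]].
  rewrite -setXI; exists (B `&` B'); first exact: measurableI.
  by exists (F `&` F') => //; exact: setI_closed_label_events.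
- move=> _; exists setT => //; exists setT; last by rewrite setXTT.
  by exists unit, (fun=> tt), setT; split => // i; rewrite preimage_cst; case: ifP.
- by rewrite bigcup_const.
- by move=> _ [B mB [F mF <-]]; exact: mecke_label_events.
- move=> _; rewrite -setXTT [X in X < _]mecke_label_events//.
    by rewrite product_measure1E// [X in _ * X]probability_setT mule1 ltey_eq fin_num_measure.
  by exists unit, (fun=> tt), setT; split => // i; rewrite preimage_cst; case: ifP.
Qed.

End mecke.

(** With a single index, the sum in [ge0_integral_transfer] reduces to the term [f w]. *)
Lemma ge0_integral_density {d} {T : measurableType d} {R : realType}
    (P m : {measure set T -> \bar R}) (r : T -> R) (f : T -> \bar R) :
  measurable_fun setT r -> (forall z, 0 <= r z) ->
  (forall A, measurable A -> P A = \int[m]_(z in A) (r z)%:E)%E ->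
  measurable_fun setT f -> (forall z, 0 <= f z)%E ->
  (\int[P]_z f z = \int[m]_z (f z * (r z)%:E))%E.
Proof.
move=> mr r0 PE mf f0.
have [] := @ge0_integral_transfer _ _ _ _ _ unit P m (fun=> [:: tt])
  (fun w _ => w) r mr r0 _ f mf f0.
  move=> A mA; split.
    rewrite (_ : (fun _ => _) = fun w => (\1_A w)%:E).
      by apply/measurable_EFinP; exact: measurable_indic.
    by apply/funext => w; rewrite big_seq1.
  under eq_integral do rewrite big_seq1.
  rewrite integral_indic// setIT PE// integral_mkcond.
  apply: eq_integral => z _; rewrite patchE indicE.
  by case: ifP; rewrite ?mul1e ?mul0e.
by move=> _ <-; apply: eq_integral => z _; rewrite big_seq1.
Qed.

Section campbell_integral.
Context {d : measure_display} {T : measurableType d} {D : set T} {R : realType}.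
Local Open Scope ereal_scope.

(** Here the indices are the points of the pattern, and the case of indicators is the definition of
    the reduced Campbell measure. *)
Lemma ge0_integral_reduced_campbell (P : {measure set (pattern D) -> \bar R})
    (f : T * pattern D -> \bar R) :
  measurable_fun setT f -> (forall z, 0 <= f z) ->
  measurable_fun setT (removal_sum (fun x X => f (x, X))) /\
  \int[P]_X removal_sum (fun x X => f (x, X)) X = \int[reduced_campbell P]_z f z.
Proof.
move=> mf f0.
have [] := @ge0_integral_transfer _ _ _ _ _ T P (reduced_campbell P)
  (fun X => val X) (fun X x => (x, delp x X)) (cst 1%R) _ _ _ f mf f0.
- exact: measurable_cst.
- by [].
- move=> A mA; split; first exact: measurable_removal_indic.
  under [RHS]eq_integral do rewrite /= mule1.
  by rewrite integral_indic// setIT.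
- by move=> mS SE; split => //; rewrite SE; under eq_integral do rewrite /= mule1.
Qed.

Variables (nu : {finite_measure set T -> \bar R}) (mu : probability (pattern D) R).
Hypothesis mu_mecke : forall A, measurable A -> reduced_campbell mu A = (nu \x mu) A.

Variables (P : probability (pattern D) R) (h : pattern D -> R)
  (lambda : T * pattern D -> R).
Hypotheses (mh : measurable_fun setT h) (h_ge0 : forall X, (0 <= h X)%R)
  (PE : forall A, measurable A -> P A = \int[mu]_(X in A) (h X)%:E).
Hypotheses (mlambda : measurable_fun setT lambda)
  (lambda_ge0 : forall z, (0 <= lambda z)%R)
  (lambdaE : forall x (X : pattern D), x \in val X ->
     h X = (lambda (x, delp x X) * h (delp x X))%R).

(** The density [h] turns an expectation under [P] into one under [mu], where Mecke's formula
    applies. By [lambdaE], [h X] becomes [lambda] times the density of the pattern without [x];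
    after Mecke's formula and Tonelli's theorem that density is absorbed back into [P]. *)
Lemma georgii_nguyen_zessin (f : T * pattern D -> \bar R) :
  measurable_fun setT f -> (forall z, 0 <= f z) ->
  \int[reduced_campbell P]_z f z = \int[nu \x P]_z (f z * (lambda z)%:E).
Proof.
move=> mf f0; have [mS <-] := ge0_integral_reduced_campbell P f mf f0.
have mflam : measurable_fun setT (fun z => f z * (lambda z)%:E).
  by apply: emeasurable_funM => //; exact/measurable_EFinP.
have mhs : measurable_fun setT (fun z : T * pattern D => (h z.2)%:E).
  by apply/measurable_EFinP; exact: measurableT_comp.
have flam0 z : 0 <= f z * (lambda z)%:E by rewrite mule_ge0// lee_fin.
pose g z := f z * (lambda z)%:E * (h z.2)%:E.
have mg : measurable_fun setT g by exact: emeasurable_funM.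
have g0 z : 0 <= g z by rewrite mule_ge0// lee_fin.
have S0 X : 0 <= removal_sum (fun x X => f (x, X)) X by exact: sume_ge0.
rewrite (ge0_integral_density P mu h _ mh h_ge0 PE mS S0).
transitivity (\int[mu]_X removal_sum (fun x X => g (x, X)) X).
  apply: eq_integral => X _; rewrite /removal_sum ge0_sume_distrl//.
  apply: eq_big_seq => x xX.
  by rewrite (lambdaE _ _ xX) EFinM muleA.
rewrite (ge0_integral_reduced_campbell mu g mg g0).2.
rewrite (eq_measure_integral (nu \x mu)%E) => [|A mA _]; last exact: mu_mecke.
rewrite !fubini_tonelli1//.
apply: eq_integral => x _; rewrite /fubini_F.
rewrite [RHS](ge0_integral_density P mu h _ mh h_ge0 PE)//.
by apply: (measurableT_comp mflam); exact: pair1_measurable.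
Qed.

End campbell_integral.

(** * Sums over an independent point process *)

Lemma indic_bigcup {T : Type} {R : realType} (F : (set T)^nat) z :
  trivIset setT F ->
  ((\1_(\bigcup_i F i) z)%:E = \sum_(i <oo) (\1_(F i) z)%:E :> \bar R)%E.
Proof.
move=> tF; case: (pselect ((\bigcup_i F i) z)) => Fz; last first.
  rewrite indicE memNset// eseries0// => i _ _.
  by rewrite indicE memNset// => Fiz; apply: Fz; exists i.
rewrite indicE mem_set//; case: Fz => n _ Fnz.
rewrite (@nneseriesD1 _ _ n)//= indicE mem_set// eseries0 ?adde0// => i _ /eqP ni.
rewrite indicE memNset// => Fiz; apply: ni.
by apply: (tF i n) => //; exists z.
Qed.

Section independent_sum.
Context {d d' : measure_display} {T : measurableType d} {D : set T}
  {Omega : measurableType d'} {R : realType}.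
Local Open Scope ereal_scope.
Variables (Pr : probability Omega R) (X Y : {RV Pr >-> pattern D}).
Variables (nu : {finite_measure set T -> \bar R}) (P : probability (pattern D) R).
Variable rho : T -> R.
Hypotheses (mrho : measurable_fun setT rho) (rho_ge0 : forall y, (0 <= rho y)%R)
  (rho_fin : \int[nu]_y (rho y)%:E < +oo).
Hypothesis X_law : forall F, measurable F -> Pr (X @^-1` F) = P F.
Hypothesis XY_indep : forall A B, measurable A -> measurable B ->
  Pr (X @^-1` A `&` Y @^-1` B) = Pr (X @^-1` A) * Pr (Y @^-1` B).
Hypothesis Y_intensity : forall B, measurable B ->
  \int[Pr]_w (count B (Y w))%:R%:E = \int[nu]_(y in B) (rho y)%:E.

(** Counting in [B] is the removal sum of the indicator of a rectangle, which is measurable by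
    [measurable_removal_indic]. *)
Lemma measurable_count (B : set T) : measurable B ->
  measurable_fun setT (fun Z : pattern D => (count B Z)%:R%:E : \bar R).
Proof.
move=> mB; rewrite (_ : (fun Z => _) =
    removal_sum (fun x Y => (\1_(B `*` [set: pattern D]) (x, Y))%:E)).
  by apply: measurable_removal_indic; exact: measurableX.
apply/funext => Z; rewrite /removal_sum sumEFin countE natr_sum.
congr (_%:E); apply: eq_bigr => x _.
by rewrite indicE in_setX in_setT andbT.
Qed.

(** The list of indices is a singleton if [X w] lies in [F] and empty otherwise, so the sum over it
    is the integrand on the left; the density is the constant [P F]. On indicators the claim is
    independence. *)
Lemma independent_integral (F : set (pattern D)) (f : pattern D -> \bar R) :
  measurable F -> measurable_fun setT f -> (forall Z, 0 <= f Z) ->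
  \int[Pr]_w ((\1_F (X w))%:E * f (Y w)) = P F * \int[Pr]_w f (Y w).
Proof.
move=> mF mf f0.
have mX A : measurable A -> measurable (X @^-1` A).
  by move=> mA; rewrite -[_ @^-1` _]setTI; exact: measurable_funP.
have mY A : measurable A -> measurable (Y @^-1` A).
  by move=> mA; rewrite -[_ @^-1` _]setTI; exact: measurable_funP.
have KE g w : \sum_(i <- if X w \in F then [:: tt] else [::]) g (Y w) =
    (\1_F (X w))%:E * g (Y w) :> \bar R.
  rewrite indicE; case: ifP => _; first by rewrite big_seq1 mul1e.
  by rewrite big_nil mul0e.
have [] := @ge0_integral_transfer _ _ _ _ _ unit Pr (distribution Pr Y)
  (fun w => if X w \in F then [:: tt] else [::]) (fun w _ => Y w)
  (cst (fine (P F))) _ _ _ f mf f0.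
- exact: measurable_cst.
- by move=> Z; exact: fine_ge0.
- move=> A mA.
  have E w : \sum_(i <- if X w \in F then [:: tt] else [::]) (\1_A (Y w))%:E =
      (\1_(X @^-1` F `&` Y @^-1` A) w)%:E :> \bar R.
    rewrite (KE (fun Z => (\1_A Z)%:E)) -EFinM !indicE in_setI -natrM mulnb.
    congr (_%:R%:E); congr (_ && _);
      by apply/idP/idP => /set_mem ?; exact: mem_set.
  split.
    rewrite (_ : (fun _ => _) = (fun w => (\1_(X @^-1` F `&` Y @^-1` A) w)%:E)).
      apply/measurable_EFinP; apply: measurable_indic.
      by apply: measurableI; [exact: mX|exact: mY].
    exact/funext.
  under eq_integral do rewrite E.
  rewrite integral_indic//; last by apply: measurableI; [exact: mX|exact: mY].
  rewrite setIT; transitivity (P F * Pr (Y @^-1` A)).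
    by rewrite -X_law// -XY_indep.
  rewrite /= ge0_integralZr; [|by []|by apply/measurable_EFinP; exact: measurable_indic
    |by move=> *; rewrite lee_fin|by rewrite lee_fin fine_ge0].
  by rewrite integral_indic// setIT fineK ?fin_num_measure// muleC.
- move=> _; under eq_integral do rewrite KE.
  move=> ->; rewrite /= ge0_integralZr//; last by rewrite lee_fin fine_ge0.
  by rewrite fineK ?fin_num_measure// muleC ge0_integral_pushforward.
Qed.

Let K (A : set (T * pattern D)) w : \bar R :=
  \sum_(y <- val (Y w)) (\1_A (y, X w))%:E.

Let K_ge0 A w : 0 <= K A w.
Proof. by apply: sume_ge0 => y _; rewrite lee_fin. Qed.

Let mrho' : measurable_fun setT (fun z : T * pattern D => rho z.1).
Proof. exact: measurableT_comp. Qed.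

Let I (A : set (T * pattern D)) := \int[nu \x P]_z ((\1_A z)%:E * (rho z.1)%:E).

Let mI A : measurable A ->
  measurable_fun setT (fun z : T * pattern D => (\1_A z)%:E * (rho z.1)%:E).
Proof.
by move=> mA; apply: emeasurable_funM; apply/measurable_EFinP.
Qed.

Let I_ge0 (A : set (T * pattern D)) z : 0 <= (\1_A z)%:E * (rho z.1)%:E.
Proof. by rewrite mule_ge0 ?lee_fin. Qed.

Let KX B F w : K (B `*` F) w = (\1_F (X w))%:E * (count B (Y w))%:R%:E.
Proof.
rewrite /K sumEFin -EFinM countE natr_sum mulr_sumr; congr (_%:E).
apply: eq_bigr => y _; rewrite !indicE in_setX/= -natrM mulnb andbC.
by [].
Qed.

Let I_rect B F : measurable B -> measurable F ->
  I (B `*` F) = P F * \int[nu]_(y in B) (rho y)%:E.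
Proof.
move=> mB mF; rewrite /I fubini_tonelli1//; last by apply: mI; exact: measurableX.
rewrite [in RHS]integral_mkcond -ge0_integralZl//; first last.
- by move=> y _; rewrite patchE; case: ifP; rewrite ?lee_fin.
- apply/(measurable_restrictT _ mB); apply/measurable_EFinP.
  exact: measurable_funTS.
apply: eq_integral => y _; rewrite /fubini_F patchE.
transitivity (\int[P]_Z ((\1_F Z)%:E * ((y \in B)%:R * rho y)%:E)).
  apply: eq_integral => Z _; rewrite -!EFinM indicE in_setX/= indicE.
  by rewrite -mulnb natrM mulrAC mulrC mulrA.
rewrite ge0_integralZr//; last by rewrite lee_fin mulr_ge0.
  rewrite integral_indic// setIT.
  by case: ifP; rewrite ?mul1r// mul0r.
by apply/measurable_EFinP; exact: measurable_indic.
Qed.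

(** The total mass of [rho] bounds every value. Finiteness permits the cancellation for complements
    in the Dynkin argument below. *)
Let I_fin A : measurable A -> I A \is a fin_num.
Proof.
move=> mA; rewrite ge0_fin_numE; last by apply: integral_ge0 => z _; exact: I_ge0.
apply: (@le_lt_trans _ _ (I setT)).
  apply: ge0_le_integral => //; [exact: mI|exact: mI|].
  move=> z _; rewrite lee_pmul// ?lee_fin// ?rho_ge0//.
  by rewrite !indicE in_setT; case: (_ \in A).
rewrite -setXTT I_rect// lte_mul_pinfty//.
exact: fin_num_measure.
Qed.

Let good A := measurable_fun setT (K A) /\ \int[Pr]_w K A w = I A.

Let good_rect B F : measurable B -> measurable F -> good (B `*` F).
Proof.
move=> mB mF; split.
  rewrite (_ : K _ = fun w => (\1_F (X w))%:E * (count B (Y w))%:R%:E).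
    apply: emeasurable_funM.
      have mF1 : measurable_fun setT (\1_F : pattern D -> R).
        exact: measurable_indic.
      apply/measurable_EFinP.
      exact: (measurableT_comp mF1).
    exact: (measurableT_comp (measurable_count B mB)).
  by apply/funext => w; exact: KX.
under eq_integral do rewrite KX.
rewrite (independent_integral F (fun Z => (count B Z)%:R%:E))//.
- by rewrite Y_intensity// I_rect.
- exact: measurable_count.
Qed.

(** On rectangles the sum factors into an indicator of [X] and a count of [Y], which are
    independent; a Dynkin class argument covers the other sets. *)
Let good_measurable A : measurable A -> good A.
Proof.
have ME := @measurable_prod_measurableType _ _ T (pattern D).
rewrite ME; move: A; apply: (@dynkin_induction _ (T * pattern D)%type _ good ME).
- move=> _ _ [B mB [F mF <-]] [B' mB' [F' mF' <-]].
  rewrite -setXI; exists (B `&` B'); first exact: measurableI.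
  by exists (F `&` F') => //; exact: measurableI.
- by rewrite -setXTT; exact: good_rect.
- by move=> _ [B mB [F mF <-]]; exact: good_rect.
- move=> S mS [mKS KSE].
  have [mKT KTE] : good setT by rewrite -setXTT; exact: good_rect.
  have CE z : (\1_(~` S) z)%:E = (\1_setT z)%:E - (\1_S z)%:E :> \bar R.
    by rewrite indicC !indicE in_setT; case: (_ \in S); rewrite -EFinB ?subrr ?subr0.
  have KC : K (~` S) = K setT \- K S.
    apply/funext => w; rewrite /K !sumEFin -EFinB -sumrB; congr (_%:E).
    by apply: eq_bigr => y _; apply: EFin_inj; rewrite CE.
  have mKC : measurable_fun setT (K (~` S)).
    by rewrite KC; exact: emeasurable_funB.
  split => //.
  have KS_fin : \int[Pr]_w K S w \is a fin_num by rewrite KSE I_fin.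
  (* Integrals are only added here; the finite value [I S] is cancelled at the end. *)
  have E1 : \int[Pr]_w K (~` S) w + \int[Pr]_w K S w = I setT.
    rewrite -KTE -ge0_integralD//; apply: eq_integral => w _.
    by rewrite KC/= subeK// /K sumEFin.
  have E2 : I (~` S) + I S = I setT.
    rewrite /I -ge0_integralD//; [|by apply: mI; exact: measurableC|exact: mI].
    apply: eq_integral => z _.
    by rewrite -ge0_muleDl ?lee_fin// CE subeK.
  have IS := I_fin S mS.
  by rewrite -[LHS](addeK _ IS) -{1}KSE E1 -E2 addeK.
- move=> F mF tF GF.
  have KU w : K (\bigcup_k F k) w = \sum_(k <oo) K (F k) w.
    rewrite /K nneseries_sum => [|*]; last by rewrite lee_fin.
    by apply: eq_bigr => y _; exact: indic_bigcup.
  split.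
    apply: (eq_measurable_fun (fun w => \sum_(i <oo | i \in predT) K (F i) w)).
      by move=> w _; rewrite KU.
    by apply: ge0_emeasurable_sum => // i _; exact: (GF i).1.
  under eq_integral do rewrite KU.
  rewrite integral_nneseries//; last by move=> n; exact: (GF n).1.
  rewrite /I (eq_integral (fun z => \sum_(i <oo) ((\1_(F i) z)%:E * (rho z.1)%:E))).
    rewrite integral_nneseries//.
      by apply: eq_eseriesr => n _; exact: (GF n).2.
    by move=> n; exact: mI.
  move=> z _; rewrite indic_bigcup// muleC -nneseriesZl.
    by apply: eq_eseriesr => n _; rewrite muleC.
  by move=> n _; rewrite lee_fin.
Qed.

Lemma independent_campbell (f : T * pattern D -> \bar R) :
  measurable_fun setT f -> (forall z, 0 <= f z) ->
  measurable_fun setT (fun w => \sum_(y <- val (Y w)) f (y, X w)) /\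
  \int[Pr]_w (\sum_(y <- val (Y w)) f (y, X w)) =
  \int[nu \x P]_z (f z * (rho z.1)%:E).
Proof.
move=> mf f0.
exact: (@ge0_integral_transfer _ _ _ _ _ T Pr (nu \x P)%E
  (fun w => val (Y w)) (fun w y => (y, X w)) (fun z => rho z.1) _ _ _ f mf f0).
Qed.

(** Positive and negative parts are treated separately by [independent_campbell]; as [rho] is
    non-negative, multiplying by it commutes with taking parts. *)
Lemma integrable_independent_sum (g : T * pattern D -> \bar R) :
  measurable_fun setT g -> (forall z, g z < +oo) ->
  (nu \x P)%E.-integrable setT (fun z => (rho z.1)%:E * g z) ->
  Pr.-integrable setT (fun w => \sum_(y <- val (Y w)) g (y, X w)) /\
  \int[Pr]_w (\sum_(y <- val (Y w)) g (y, X w)) =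
  \int[nu \x P]_z ((rho z.1)%:E * g z).
Proof.
move=> mg goo ig; pose rg z := (rho z.1)%:E * g z.
have [mp Ep] := independent_campbell _ (measurable_funepos mg) (funepos_ge0 g).
have [mn En] := independent_campbell _ (measurable_funeneg mg) (funeneg_ge0 g).
have rp z : g^\+ z * (rho z.1)%:E = rg^\+ z.
  by rewrite muleC !funeposE maxe_pMr ?lee_fin// [X in maxe _ X]mule0.
have rn z : g^\- z * (rho z.1)%:E = rg^\- z.
  by rewrite muleC !funenegE /rg -muleN maxe_pMr ?lee_fin// [X in maxe _ X]mule0.
have Sp0 w : 0 <= \sum_(y <- val (Y w)) g^\+ (y, X w) by exact: sume_ge0.
have Sn0 w : 0 <= \sum_(y <- val (Y w)) g^\- (y, X w) by exact: sume_ge0.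
have SE : (fun w => \sum_(y <- val (Y w)) g (y, X w)) =
    (fun w => \sum_(y <- val (Y w)) g^\+ (y, X w)) \-
    (fun w => \sum_(y <- val (Y w)) g^\- (y, X w)).
  apply/funext => w; rewrite /= -sumeN => [|y y' _ _]; last first.
    by rewrite ge0_adde_def ?inE.
  rewrite -big_split/=; apply: eq_bigr => y _.
  by rewrite [in LHS](funeposneg g).
have ip : Pr.-integrable setT (fun w => \sum_(y <- val (Y w)) g^\+ (y, X w)).
  apply/integrableP; split => //; under eq_integral do rewrite gee0_abs//.
  by rewrite Ep; under eq_integral do rewrite rp; exact: integral_funepos_lt_pinfty.
have in_ : Pr.-integrable setT (fun w => \sum_(y <- val (Y w)) g^\- (y, X w)).
  apply/integrableP; split => //; under eq_integral do rewrite gee0_abs//.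
  by rewrite En; under eq_integral do rewrite rn; exact: integral_funeneg_lt_pinfty.
rewrite SE; split; first exact: integrableB.
rewrite integralB// Ep En [RHS]integralE.
by congr (_ - _); apply: eq_integral => z _; rewrite ?rp ?rn.
Qed.

End independent_sum.

(** * The planar domain *)

Section plane.
Context {R : realType}.

Lemma nbhs_rat_itv (x : R) (U : set R) : nbhs x U ->
  exists ab : rat * rat, [/\ ratr ab.1 < x, x < ratr ab.2 &
    `]ratr ab.1, ratr ab.2[%classic `<=` U].
Proof.
move=> /nbhs_ballP[e /= e0 eU].
have [|a] := @rat_in_itvoo R (x - e) x; first by rewrite ltrBlDr ltrDl.
have [|b] := @rat_in_itvoo R x (x + e); first by rewrite ltrDl.
rewrite !in_itv/= => /andP[xb be] /andP[ea ax]; exists (a, b); split => // y.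
rewrite /= in_itv/= => /andP[ay yb]; apply: eU; rewrite /ball/= ltr_norml; lra.
Qed.

(** The plane carries the product sigma-algebra, so an open set is written as the countable union of
    the rectangles with rational endpoints that it contains. *)
Lemma open_measurable_plane (O : set (plane R)) : open O -> measurable O.
Proof.
move=> oO; pose J := ((rat * rat) * (rat * rat))%type.
pose B (i : J) : set (plane R) :=
  `]ratr i.1.1, ratr i.1.2[%classic `*` `]ratr i.2.1, ratr i.2.2[%classic.
pose A (i : J) : set (plane R) := if `[< B i `<=` O >] then B i else set0.
rewrite (_ : O = \bigcup_i A i).
  apply: countable_bigcupT_measurable => [|i]; first exact: countableP.
  rewrite /A; case: ifP => // _; apply: measurableX; exact: measurable_itv.
apply/seteqP; split => [[x y] Oxy|z [i _]]; last first.
  by rewrite /A; case: asboolP => //; apply.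
have [[U V] /= [Ux Vy] UVO] : nbhs (x, y) O by exact: open_nbhs_nbhs.
have [a [ax xa aU]] := nbhs_rat_itv _ _ Ux.
have [b [bx xb bV]] := nbhs_rat_itv _ _ Vy.
exists (a, b) => //; rewrite /A ifT.
  by split; rewrite /= in_itv/=; apply/andP.
by apply/asboolP => -[u v] [/= /aU Uu /bV Vv]; exact: UVO.
Qed.

Lemma compact_measurable_plane (D : set (plane R)) : compact D -> measurable D.
Proof.
move=> cD; rewrite -[D]setCK; apply: measurableC; apply: open_measurable_plane.
apply: closed_openC; apply: compact_closed => //.
Qed.

(** Both coordinate projections of a compact set are bounded, so the set fits in a box. *)
Lemma compact_area_lty (D : set (plane R)) : compact D -> (area R D < +oo)%E.
Proof.
move=> cD; have mD := compact_measurable_plane _ cD.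
have cfst : compact (fst @` D : set R).
  apply: continuous_compact => //; apply: continuous_subspaceT => z; exact: cvg_fst.
have csnd : compact (snd @` D : set R).
  apply: continuous_compact => //; apply: continuous_subspaceT => z; exact: cvg_snd.
have [M [_ MD]] := compact_bounded cfst.
have [M' [_ MD']] := compact_bounded csnd.
(* The bounds hold only for numbers strictly above [M] and [M'], hence the added 1. *)
pose m := `|M| + 1 ; pose m' := `|M'| + 1.
have Mm : M < m by rewrite (le_lt_trans (ler_norm _))// ltrDl.
have Mm' : M' < m' by rewrite (le_lt_trans (ler_norm _))// ltrDl.
pose B : set (plane R) := `[- m, m]%classic `*` `[- m', m']%classic.
have DB : D `<=` B.
  move=> [x y] Dxy; split => /=; rewrite in_itv/= -ler_norml.
    by apply: (MD m Mm); exists (x, y).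
  by apply: (MD' m' Mm'); exists (x, y).
apply: (@le_lt_trans _ _ (area R B)).
  apply: le_measure; rewrite ?inE//.
  by apply: measurableX; exact: measurable_itv.
have -> : area R B = (lebesgue_measure `[(- m)%R, m]%classic *
    lebesgue_measure `[(- m')%R, m']%classic)%E.
  by apply: product_measure1E; exact: measurable_itv.
by rewrite !lebesgue_measure_itv/=; case: ifP => _; case: ifP => _;
  rewrite ?mul0e ?mule0// -?EFinB -?EFinM ltry.
Qed.

(** [unit_poisson] speaks of regions inside [D] indexed by ordinals: the cells are cut down to [D],
    which changes no count, and enumerated by [enum_val]. *)
Lemma unit_poisson_label {D : set (plane R)} (mu : probability (pattern D) R)
    {I : finType} (l : plane R -> I) (k : {ffun I -> nat}) :
  measurable D -> unit_poisson mu -> measurable_label l ->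
  mu [set X | label_counts l X = k] =
  (\prod_i poisson_weight (fine (area R (l @^-1` [set i] `&` D))) (k i))%:E.
Proof.
move=> mD muP ml.
pose E (i : 'I_#|I|) := l @^-1` [set enum_val i] `&` D.
have mE i : measurable (E i) by apply: measurableI => //; exact: ml.
have ED i : E i `<=` D by exact: subIsetr.
have tE : trivIset setT E.
  move=> i j _ _ [x [[/= lx _] [/= + _]]]; rewrite lx.
  by move=> /enum_val_inj.
have := muP _ E (fun i => k (enum_val i)) mE ED tE.
move=> muE; transitivity (\prod_(i < #|I|)
    poisson_weight (fine (area R (E i))) (k (enum_val i)))%:E; last first.
  congr (_%:E); rewrite [RHS](reindex (@enum_val I I))//=.
  by apply: onW_bij; exact: enum_val_bij.
rewrite -muE; congr (mu _); apply/seteqP; split => X /=.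
  by move=> <- i; rewrite /E setIC count_setI ffunE.
move=> kE; apply/ffunP => i; rewrite ffunE -count_setI setIC.
by rewrite -(enum_rankK i); exact: kE.
Qed.

End plane.

(** * The logistic criterion *)

Lemma ln_ratio_le {R : realType} (x y : R) : 0 < x -> 0 < y ->
  ln x - ln y <= x / y - 1.
Proof.
move=> x0 y0; rewrite -ln_div ?posrE//.
have xy0 : 0 < x / y by rewrite divr_gt0.
have := @le_ln1Dx R (x / y - 1); rewrite [1 + _]addrC subrK; apply.
by rewrite ltrBrDl subrr.
Qed.

(* Gibbs' inequality for Bernoulli(a / (a + r)) and Bernoulli(c / (c + r)). *)
Lemma gibbs_ln {R : realType} (a c r : R) : 0 < a -> 0 < c -> 0 < r ->
  a * ln (c / (c + r)) - r * ln (c + r) <= a * ln (a / (a + r)) - r * ln (a + r).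
Proof.
move=> a0 c0 r0.
have ar : 0 < a + r by rewrite addr_gt0.
have cr : 0 < c + r by rewrite addr_gt0.
have p0 : 0 < c / (c + r) by rewrite divr_gt0.
have q0 : 0 < a / (a + r) by rewrite divr_gt0.
have h1 := ler_wpM2l (ltW a0) (ln_ratio_le _ _ p0 q0).
have h2 := ler_wpM2l (ltW r0) (ln_ratio_le _ _ ar cr).
(* The weighted bounds cancel exactly because c / (c + r) and r / (c + r) sum to 1. *)
have E : a * (c / (c + r) / (a / (a + r)) - 1) + r * ((a + r) / (c + r) - 1) = 0.
  by field; rewrite !gt_eqF.
lra.
Qed.

(** For positive arguments this is [gibbs_ln]. If a = 0 the first terms vanish and the logarithm is
    monotone; if c = 0 < a with c and a distinct the left side is -oo, also for r = 0, where 0 / 0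
    is 0; if r = 0 with a and c positive both sides are 0. *)
Lemma lne_gibbs {R : realType} (a c r : R) : 0 <= a -> 0 <= c -> 0 <= r ->
  (lne (c / (c + r))%:E * a%:E - r%:E * lne (c + r)%:E <=
   lne (a / (a + r))%:E * a%:E - r%:E * lne (a + r)%:E)%E.
Proof.
rewrite [0 <= a]le_eqVlt [0 <= c]le_eqVlt [0 <= r]le_eqVlt.
move=> /predU1P[<-|a0] /predU1P[<-|c0] /predU1P[<-|r0];
  rewrite ?(addr0, add0r, mul0r, mule0, mul0e, sube0, mulr0, mul1e) ?lexx//.
- rewrite !lne_EFin ?addr_gt0// leeN2 lee_fin ler_wpM2l ?ltW//.
  by rewrite ltr_ln ?posrE ?addr_gt0// ltrDr.
- rewrite divff ?gt_eqF// lne1 mul0e.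
  by rewrite /= lexx gt0_mulNye ?lte_fin// leNye.
- by rewrite [lne 0%:E]/= lexx gt0_mulNye ?lte_fin// addNye leNye.
- by rewrite !divff ?gt_eqF.
- rewrite !lne_EFin ?divr_gt0 ?addr_gt0// -!EFinM -!EFinB lee_fin.
  by rewrite ![_ * a]mulrC gibbs_ln.
Qed.

Lemma measurable_lne_EFin {R : realType} :
  measurable_fun setT (fun x : R => lne x%:E).
Proof.
rewrite (_ : (fun x => _) = fun x : R => if x <= 0 then -oo%E else (ln x)%:E)//.
apply: measurable_fun_ifT => //.
  exact: measurable_fun_ler.
by apply/measurable_EFinP; exact: measurable_ln.
Qed.

(** * Restriction to the domain and measurability of the integrands *)

Section restricted_integral.
Context {d : measure_display} {T : measurableType d} {R : realType}.
Variables (m nu : {measure set T -> \bar R}) (D : set T) (mD : measurable D).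
Hypothesis nuE : forall A, measurable A -> nu A = m (A `&` D).
Local Open Scope ereal_scope.

(** The indicator of [D] is a density of [nu] with respect to [m]. *)
Lemma ge0_integral_restr (f : T -> \bar R) : measurable_fun setT f ->
  (forall x, 0 <= f x) -> \int[nu]_x f x = \int[m]_(x in D) f x.
Proof.
move=> mf f0; rewrite (ge0_integral_density (nu) m (\1_D))//.
  rewrite [RHS]integral_mkcond; apply: eq_integral => x _.
  by rewrite patchE indicE; case: ifP; rewrite ?mule1 ?mule0.
by move=> A mA; rewrite nuE// integral_indic// setIC.
Qed.

Lemma integral_restr (f : T -> \bar R) : measurable_fun setT f ->
  \int[nu]_x f x = \int[m]_(x in D) f x.
Proof.
move=> mf; rewrite [LHS]integralE [RHS]integralE.
by rewrite !ge0_integral_restr//; [exact: measurable_funeneg|exact: measurable_funepos].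
Qed.

End restricted_integral.

Section logistic_terms.
Context {R : realType} {D : set (plane R)}.
Variables (mD : measurable D) (lambda : plane R -> pattern D -> R)
  (rho : plane R -> R).
Local Open Scope ereal_scope.
Notation DX := (D `*` [set: pattern D]).
Hypotheses (mlambda : measurable_fun DX (fun z => lambda z.1 z.2))
  (lambda_ge0 : forall x X, D x -> (0 <= lambda x X)%R).
Hypotheses (mrho : measurable_fun D rho)
  (rho_ge0 : forall u, D u -> (0 <= rho u)%R).

Let mDX : measurable DX.
Proof. exact: measurableX. Qed.

Lemma measurable_total : measurable_fun DX (fun z => lambda z.1 z.2 + rho z.1)%R.
Proof.
apply: measurable_funD => //; apply: (measurable_comp mD) => //.
  by move=> _ [z [Dz _] <-].
exact: measurable_funTS.
Qed.

Lemma measurable_log_total :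
  measurable_fun DX (fun z => log_total lambda rho z.1 z.2).
Proof. exact: (measurableT_comp measurable_lne_EFin measurable_total). Qed.

Lemma measurable_log_ratio :
  measurable_fun DX (fun z => log_ratio lambda rho z.1 z.2).
Proof.
(* The inverse becomes a real power with exponent -1, to which [measurable_powR] applies; the two
   agree as the base is non-negative. *)
apply: (eq_measurable_fun (fun z => lne (lambda z.1 z.2 *
    (lambda z.1 z.2 + rho z.1) `^ (-1))%:E)).
  move=> z /set_mem[Dz _]; rewrite /log_ratio powR_inv1// addr_ge0//.
    exact: lambda_ge0.
  exact: rho_ge0.
apply: (measurableT_comp measurable_lne_EFin); apply: measurable_funM => //.
exact: (measurableT_comp (measurable_powR _) measurable_total).
Qed.

Lemma log_ratio_le0 u X : D u -> log_ratio lambda rho u X <= 0.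
Proof.
move=> Du; rewrite /log_ratio lne_le0 lee_fin.
have l0 := lambda_ge0 u X Du; have r0 := rho_ge0 u Du.
(* Where the denominator vanishes the quotient is 0 by convention. *)
have [->|t0] := eqVneq (lambda u X + rho u)%R 0%R; first by rewrite invr0 mulr0.
by rewrite ler_pdivrMr ?mul1r ?lerDl// lt_neqAle eq_sym t0 addr_ge0.
Qed.

Lemma log_total_lty u X : log_total lambda rho u X < +oo.
Proof. by rewrite /log_total /lne; case: ifP => _; rewrite ?ltry. Qed.

End logistic_terms.

Lemma addp_delp {d} {T : measurableType d} {D : set T} x (X : pattern D) :
  x \in val X -> addp x (delp x X) = X.
Proof.
move=> xX; apply: val_inj; apply/fsetP => y; rewrite !inE/=.
have [->|yx]/= := eqVneq y x; first by rewrite xX mem_set//; exact: val_pattern_sub xX.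
case: (boolP (y \in val X)) => //= yX.
by rewrite mem_set//; exact: val_pattern_sub yX.
Qed.

(** * The criterion as one integral, its maximum and its estimator *)

Section Mrho_integral.
Context {R : realType} {D : set (plane R)}.
Variables (cD : compact D) (mu : probability (pattern D) R)
  (mu_poisson : unit_poisson mu).
Variables (P : probability (pattern D) R) (h : pattern D -> R)
  (lambda_star : plane R -> pattern D -> R).
Hypotheses (h_density : is_density mu P h) (h_hereditary : hereditary h)
  (h_papangelou : papangelou_intensity h lambda_star).
Variable rho : plane R -> R.
Hypotheses (rho_ge0 : forall u, D u -> (0 <= rho u)%R)
  (mrho : measurable_fun D rho).
Local Open Scope ereal_scope.
Notation DX := (D `*` [set: pattern D]).

Let mD : measurable D := compact_measurable_plane _ cD.

Let mDX : measurable DX.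
Proof. exact: measurableX. Qed.

Variable nu : {finite_measure set (plane R) -> \bar R}.
Hypothesis nuE : forall A, measurable A -> nu A = area R (A `&` D).

Let ge0_integral_nu (f : plane R -> \bar R) : measurable_fun setT f ->
  (forall u, 0 <= f u) -> \int[nu]_u f u = \int[area R]_(u in D) f u.
Proof. exact: ge0_integral_restr. Qed.

Let integral_nu (f : plane R -> \bar R) : measurable_fun setT f ->
  \int[nu]_u f u = \int[area R]_(u in D) f u.
Proof. exact: integral_restr. Qed.

(** Extending by zero outside [D] yields a function that is non-negative and measurable everywhere,
    whereas [lambda_star] is only controlled on [D]. *)
Definition star_intensity : plane R * pattern D -> R :=
  (fun z => lambda_star z.1 z.2) \_ DX.
Local Notation lam := star_intensity.

Let mlam : measurable_fun setT lam.
Proof. by apply/(measurable_restrictT _ mDX); case: h_papangelou. Qed.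

Let lam_ge0 z : (0 <= lam z)%R.
Proof.
rewrite /lam patchE; case: ifP => // /set_mem[Dz _].
by case: h_papangelou => _ + _; apply.
Qed.

(* Since h is hereditary this also holds where lambda_star is unconstrained,
   and it makes the measurability of X |-> X U {x} unnecessary. *)
Lemma density_removal x (X : pattern D) : x \in val X ->
  h X = (lam (x, delp x X) * h (delp x X))%R.
Proof.
move=> xX; have Dx := val_pattern_sub _ _ xX.
rewrite /lam patchE mem_set//=.
have [h0|h0] := eqVneq (h (delp x X)) 0%R.
  by rewrite h0 mulr0 -(addp_delp _ _ xX) h_hereditary.
case: h_papangelou => _ _ ->//.
by rewrite divfK// addp_delp.
Qed.

Lemma ge0_integral_campbell (f : plane R * pattern D -> \bar R) :
  measurable_fun setT f -> (forall z, 0 <= f z) ->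
  \int[reduced_campbell P]_z f z = \int[nu \x P]_z (f z * (lam z)%:E).
Proof.
case: h_density => mh h0 PE.
apply: (@georgii_nguyen_zessin _ _ _ _ nu mu _ P h lam) => //.
- move=> A mA; apply: mecke => // I l k ml.
  rewrite (unit_poisson_label mu l k mD mu_poisson ml); congr (_%:E).
  by apply: eq_bigr => i _; rewrite nuE//; exact: ml.
- exact: density_removal.
Qed.

Section one_theta.
Variable lambda : plane R -> pattern D -> R.
Hypotheses (mlambda : measurable_fun DX (fun z => lambda z.1 z.2))
  (lambda_ge0 : forall x X, D x -> (0 <= lambda x X)%R).
Hypothesis cvM : Mrho_converges lambda rho P.

Definition log_ratio_in := (fun z => log_ratio lambda rho z.1 z.2) \_ DX.
Definition log_total_in := (fun z => log_total lambda rho z.1 z.2) \_ DX.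
Local Notation fr := log_ratio_in.
Local Notation gt := log_total_in.
Local Notation r0 := (rho \_ D).

Lemma measurable_log_ratio_in : measurable_fun setT fr.
Proof. by apply/(measurable_restrictT _ mDX); exact: measurable_log_ratio. Qed.

Lemma measurable_log_total_in : measurable_fun setT gt.
Proof. by apply/(measurable_restrictT _ mDX); exact: measurable_log_total. Qed.

Lemma log_ratio_in_le0 z : fr z <= 0.
Proof.
rewrite /fr patchE; case: ifP => // /set_mem[Dz _].
exact: log_ratio_le0.
Qed.

Lemma log_total_in_lty z : gt z < +oo.
Proof. by rewrite /gt patchE; case: ifP => _; [exact: log_total_lty|exact: ltry]. Qed.

Let mfrlam : measurable_fun setT (fun z => fr z * (lam z)%:E).
Proof.
by apply: emeasurable_funM; [exact: measurable_log_ratio_in|exact/measurable_EFinP].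
Qed.

(** The logarithm of the ratio never exceeds 0, so its opposite falls under the formula for
    non-negative functions without any integrability. *)
Lemma campbell_log_ratio :
  \int[reduced_campbell P]_z - fr z = - \int[nu \x P]_z (fr z * (lam z)%:E).
Proof.
have nf0 z : 0 <= - fr z by rewrite oppe_ge0 log_ratio_in_le0.
rewrite (ge0_integral_campbell (fun z => - fr z))//; last first.
  by apply: measurableT_comp => //; exact: measurable_log_ratio_in.
rewrite -[LHS]oppeK -integral_ge0N => [|z _]; last by rewrite mule_ge0 ?lee_fin.
by congr (- _); apply: eq_integral => z _; rewrite mulNe oppeK.
Qed.

(** The absolute value of the integrand is its opposite, whose integral [ge0_integral_campbell]
    identifies with the first of the two that [cvM] assumes finite. *)
Lemma integrable_log_ratio :
  (nu \x P)%E.-integrable setT (fun z => fr z * (lam z)%:E).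
Proof.
case: cvM => c1 _; apply/integrableP; split; first exact: mfrlam.
have nf0 z : 0 <= - fr z by rewrite oppe_ge0 log_ratio_in_le0.
rewrite (eq_integral (fun z => - fr z * (lam z)%:E)) => [|z _]; last first.
  by rewrite lee0_abs ?mulNe// mule_le0_ge0 ?log_ratio_in_le0// lee_fin.
rewrite -(ge0_integral_campbell (fun z => - fr z))//; last first.
  by apply: measurableT_comp => //; exact: measurable_log_ratio_in.
move: c1; rewrite integral_mkcond; congr (_ < _); apply: eq_integral => z _.
rewrite /fr !patchE; case: ifPn => [/set_mem[Dz _]|_]; last by rewrite oppe0.
by rewrite lee0_abs//; exact: log_ratio_le0.
Qed.

Lemma integral_log_ratio :
  \int[reduced_campbell P]_(z in DX) log_ratio lambda rho z.1 z.2 =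
  \int[nu \x P]_z (fr z * (lam z)%:E).
Proof.
rewrite -[RHS]oppeK -campbell_log_ratio -integral_ge0N => [|z _]; last first.
  by rewrite oppe_ge0 log_ratio_in_le0.
by rewrite [LHS]integral_mkcond; apply: eq_integral => z _; rewrite oppeK.
Qed.

Let mrg : measurable_fun setT (fun z : plane R * pattern D => (r0 z.1)%:E * gt z).
Proof.
apply: emeasurable_funM; last exact: measurable_log_total_in.
apply/measurable_EFinP; apply: (measurableT_comp (f := r0)) => //.
exact/(measurable_restrictT _ mD).
Qed.

Let rgE u X : u \in D ->
  (r0 u)%:E * gt (u, X) = (rho u)%:E * log_total lambda rho u X.
Proof. by move=> Du; rewrite /gt !patchE Du in_setX Du in_setT. Qed.

(** Tonelli's theorem reduces this to the second finite integral in [cvM]. *)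
Lemma integrable_log_total :
  (nu \x P)%E.-integrable setT (fun z => (r0 z.1)%:E * gt z).
Proof.
suff E : \int[nu]_u \int[P]_X `|(r0 u)%:E * gt (u, X)| =
    \int[area R]_(u in D) \int[P]_X `|(rho u)%:E * log_total lambda rho u X|.
  by apply/(integrable12ltyP nu P mrg); rewrite E; exact: cvM.2.
rewrite ge0_integral_nu; first last.
- by move=> x; exact: integral_ge0.
- apply: (@measurable_fun_fubini_tonelli_F _ _ _ _ _ P
    (abse \o (fun z => (r0 z.1)%:E * gt z))) => //=.
  exact: measurableT_comp.
by apply: eq_integral => u Du; apply: eq_integral => X _; rewrite -rgE.
Qed.

Lemma integral_log_total :
  \int[area R]_(u in D) \int[P]_X ((rho u)%:E * log_total lambda rho u X) =
  \int[nu \x P]_z ((r0 z.1)%:E * gt z).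
Proof.
rewrite -(integral12_prod_meas1 integrable_log_total) integral_nu; last first.
  exact: measurable_fubini_F integrable_log_total.
by apply: eq_integral => u Du; apply: eq_integral => X _; rewrite rgE.
Qed.

(** With both terms integrable against the same measure, comparing two criteria becomes a comparison
    of integrands. *)
Lemma MrhoE : Mrho lambda rho P =
  \int[nu \x P]_z (fr z * (lam z)%:E - (r0 z.1)%:E * gt z).
Proof.
rewrite /Mrho integral_log_ratio integral_log_total integralB//.
  exact: integrable_log_ratio.
exact: integrable_log_total.
Qed.

Context {d : measure_display} {Omega : measurableType d} (Pr : probability Omega R).
Variables X Y : {RV Pr >-> pattern D}.
Hypotheses (X_law : has_law X P) (XY_indep : independent_patterns X Y)
  (Y_intensity : has_intensity Y rho).
Hypothesis rho_integrable : (area R).-integrable D (fun u => (rho u)%:E).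

Let r0_ge0 u : (0 <= r0 u)%R.
Proof. by rewrite patchE; case: ifP => // /set_mem; exact: rho_ge0. Qed.

Let mr0 : measurable_fun setT r0.
Proof. exact/(measurable_restrictT _ mD). Qed.

Let r0_fin : \int[nu]_u (r0 u)%:E < +oo.
Proof.
rewrite ge0_integral_nu; [|exact/measurable_EFinP|by move=> u; rewrite lee_fin].
case/integrableP: rho_integrable => _; congr (_ < _).
apply: eq_integral => u Du; rewrite patchE Du gee0_abs// lee_fin.
by apply: rho_ge0; exact: set_mem.
Qed.

Let count_intensity B : measurable B ->
  \int[Pr]_w (count B (Y w))%:R%:E = \int[nu]_(u in B) (r0 u)%:E.
Proof.
move=> mB; transitivity (\int[Pr]_w (\sum_(y <- val (Y w)) (\1_B y : R)%:E)).
  apply: eq_integral => w _; rewrite sumEFin countE natr_sum.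
  by congr (_%:E); apply: eq_bigr => y _; rewrite indicE.
(* The intensity is tested on the indicator of [B]. *)
rewrite Y_intensity//.
rewrite [RHS]integral_mkcond ge0_integral_nu.
- apply: eq_integral => u Du; rewrite patchE indicE.
  by case: ifP => _; rewrite ?mul1r ?mul0r// patchE Du.
- apply/(measurable_restrictT _ mB); apply/measurable_EFinP.
  exact: measurable_funTS.
- by move=> u; rewrite patchE; case: ifP; rewrite ?lee_fin.
Qed.

(** The points of a pattern lie in [D], so cutting the integrands down to [D] is invisible. The
    first sum is taken over opposite terms, which are non-negative, so that negation passes through
    the sum. *)
Lemma estimatorE w : estimator lambda rho X Y w =
  - removal_sum (fun x Z => - fr (x, Z)) (X w) -
  \sum_(y <- val (Y w)) gt (y, X w).
Proof.
have inDX x (Z Z' : pattern D) : x \in val Z -> (x, Z') \in DX.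
  by move=> /val_pattern_sub Dx; rewrite in_setX in_setT mem_set.
rewrite /estimator /removal_sum; congr (_ - _); last first.
  by apply: eq_big_seq => x xZ; rewrite /gt patchE (inDX _ _ _ xZ).
rewrite -sumeN => [|x x' _ _]; last first.
  by apply: ge0_adde_def; rewrite inE/= oppe_ge0; exact: log_ratio_in_le0.
by apply: eq_big_seq => x xZ; rewrite oppeK /fr patchE (inDX _ _ _ xZ).
Qed.

Lemma estimator_unbiased :
  unbiased_for Pr (estimator lambda rho X Y) (Mrho lambda rho P).
Proof.
have nf0 z : 0 <= - fr z by rewrite oppe_ge0 log_ratio_in_le0.
have mnf : measurable_fun setT (fun z => - fr z).
  by apply: measurableT_comp => //; exact: measurable_log_ratio_in.
pose S := removal_sum (fun x Z => - fr (x, Z)).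
have [mS SE] := ge0_integral_reduced_campbell P _ mnf nf0.
have S0 Z : 0 <= S Z by exact: sume_ge0.
have mSX : measurable_fun setT (S \o X) by exact: measurableT_comp.
(* As [X] has law [P], the expected sum is an integral against the reduced Campbell measure of [P],
   which [campbell_log_ratio] evaluates. *)
have ES : \int[Pr]_w S (X w) = - \int[nu \x P]_z (fr z * (lam z)%:E).
  rewrite -campbell_log_ratio -SE.
  transitivity (\int[distribution Pr X]_Z S Z).
    by rewrite ge0_integral_pushforward.
  by apply: eq_measure_integral => A mA _; exact: X_law.
have iS : Pr.-integrable setT (S \o X).
  apply/integrableP; split => //; under eq_integral do rewrite /= gee0_abs//.
  rewrite ES ltey_eq fin_numN; apply/orP; left.
  exact: integrable_fin_num integrable_log_ratio.
(* Independence and the intensity of [Y] give the expected sum over [Y] as an integral against the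
   product of [nu] and [P]. *)
have [iG EG] := integrable_independent_sum Pr X Y nu P r0 mr0 r0_ge0 r0_fin X_law
  XY_indep count_intensity gt measurable_log_total_in log_total_in_lty
  integrable_log_total.
have -> : estimator lambda rho X Y = (fun w => - S (X w)) \-
    (fun w => \sum_(y <- val (Y w)) gt (y, X w)).
  by apply/funext => w; rewrite estimatorE.
have iSN : Pr.-integrable setT (fun w => - S (X w)) by exact: integrableN iS.
split; first exact: integrableB.
rewrite integralB// EG integral_ge0N// ES oppeK MrhoE integralB//.
  exact: integrable_log_ratio.
exact: integrable_log_total.
Qed.

End one_theta.

Lemma Mrho_le_star (lambda : plane R -> pattern D -> R) :
  measurable_fun DX (fun z => lambda z.1 z.2) ->
  (forall x X, D x -> (0 <= lambda x X)%R) ->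
  Mrho_converges lambda rho P -> Mrho_converges lambda_star rho P ->
  Mrho lambda rho P <= Mrho lambda_star rho P.
Proof.
move=> mla la0 cv cvs; have [mls ls0 _] := h_papangelou.
rewrite !MrhoE//; apply: le_integral => //.
1,2: by apply: integrableB => //;
  [exact: integrable_log_ratio|exact: integrable_log_total].
(* Both integrands vanish outside [D]; on [D] this is [lne_gibbs] with a the value of [lambda_star],
   c that of [lambda] and r that of [rho]. *)
move=> [u X] _; rewrite /log_ratio_in /log_total_in /lam !patchE in_setX in_setT andbT /=.
case: ifPn => [/set_mem Du|_]; last by rewrite !mul0e.
by apply: lne_gibbs; [exact: ls0|exact: la0|exact: rho_ge0].
Qed.

End Mrho_integral.

Theorem mainTheorem3 (R : realType) (D : set (plane R)) (cD : compact D)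
    (mu : probability (pattern D) R) (mu_poisson : unit_poisson mu)
    (Theta : Type)
    (P : Theta -> probability (pattern D) R)
    (h : Theta -> pattern D -> R)
    (h_density : forall theta, is_density mu (P theta) (h theta))
    (h_hereditary : forall theta, hereditary (h theta))
    (lambda : Theta -> plane R -> pattern D -> R)
    (lambda_papangelou : forall theta,
      papangelou_intensity (h theta) (lambda theta))
    (rho : plane R -> R)
    (rho_ge0 : forall u, D u -> 0 <= rho u)
    (rho_integrable : (area R).-integrable D (fun u => (rho u)%:E)) :
  forall theta_star : Theta,
  (forall theta, Mrho_converges (lambda theta) rho (P theta_star)) ->
  (forall theta, (Mrho (lambda theta) rho (P theta_star) <=
                  Mrho (lambda theta_star) rho (P theta_star))%E) /\
  (forall (d : measure_display) (Omega : measurableType d)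
      (Pr : probability Omega R) (X Y : {RV Pr >-> pattern D}),
    has_law X (P theta_star) ->
    independent_patterns X Y ->
    has_intensity Y rho ->
    forall theta,
      unbiased_for Pr (estimator (lambda theta) rho X Y)
        (Mrho (lambda theta) rho (P theta_star))).
Proof.
move=> ts cvM.
have mrho : measurable_fun D rho.
  by apply/measurable_EFinP; exact: measurable_int rho_integrable.
have mD := compact_measurable_plane D cD.
(* The area restricted to [D], finite since [D] is compact, is a measure on the whole plane; its
   product with [P ts] carries all the integrals. *)
pose nu : {finite_measure set (plane R) -> \bar R} :=
  mfrestr mD (compact_area_lty D cD).
have nuE A : measurable A -> nu A = area R (A `&` D) by [].
split=> [theta|d Omega Pr X Y X_law XY_indep Y_intensity theta];
  have [mla la0 _] := lambda_papangelou theta.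
  exact: (Mrho_le_star cD mu mu_poisson (P ts) (h ts) (lambda ts) (h_density ts)
    (h_hereditary ts) (lambda_papangelou ts) rho rho_ge0 mrho nu nuE _ mla la0
    (cvM theta) (cvM ts)).
exact: (estimator_unbiased cD mu mu_poisson (P ts) (h ts) (lambda ts) (h_density ts)
  (h_hereditary ts) (lambda_papangelou ts) rho rho_ge0 mrho nu nuE _ mla la0
  (cvM theta) Pr X Y X_law XY_indep Y_intensity rho_integrable).
Qed.
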